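(* Let $G(r,z)$ be a real symmetric $(D-2)\times(D-2)$ matrix-valued function on $\{r\ge 0\}$, continuous, with $|\det G|=r^2$, satisfying $G^{-1}\vec\nabla^2G=(G^{-1}\vec\nabla G)^2$ for $r>0$, and such that $G$ and its derivatives remain finite as $r\to0$ (except possibly at isolated values of $z$). Let $[z_1,z_2]$ be a rod of $G$, i.e. an interval of the $z$-axis such that $\dim\ker G(0,z)=1$ for all $z\in\,]z_1,z_2[$ (bounded by consecutive isolated values of $z$ where this fails). Then there exists a constant orthogonal matrix $\Lambda_*$ such that $\tilde G(r,z)=\Lambda_*^TG(r,z)\Lambda_*$ satisfies $\tilde G_{1i}(0,z)=0$ for all $i=1,\dots,D-2$ and all $z\in[z_1,z_2]$.
   Context: Here $\vec\nabla^2=\partial_r^2+\frac1r\partial_r+\partial_z^2$ and $(G^{-1}\vec\nabla G)^2=(G^{-1}\partial_rG)^2+(G^{-1}\partial_zG)^2$ (gradient of a flat 3D Euclidean space $dr^2+r^2d\gamma^2+dz^2$ acting on axisymmetric fields). Rods: the $z$-axis at $r=0$ is divided by isolated points $a_1<\dots<a_N$, at which $\dim\ker G(0,z)\neq1$, into intervals $[-\infty,a_1],[a_1,a_2],\dots,[a_N,\infty]$, on whose interiors $\dim\ker G(0,z)=1$; these intervals are called rods. *)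

(* Defs.v *)
From HB Require Import structures.
From mathcomp Require Import all_boot all_order all_algebra.
From mathcomp Require Import all_classical all_reals all_analysis.
Set Implicit Arguments. Unset Strict Implicit. Unset Printing Implicit Defensive.
Import Order.TTheory GRing.Theory Num.Theory.
Import numFieldNormedType.Exports.
Local Open Scope ring_scope.
Local Open Scope classical_set_scope.

Section Defs.
Variables (R : realType) (n : nat).

Definition mxfield := R -> R -> 'M[R]_n.

Definition d_r (G : mxfield) : mxfield :=
  fun r z => \matrix_(i, j) (fun s => G s z i j)^`() r.
Definition d_z (G : mxfield) : mxfield :=
  fun r z => \matrix_(i, j) (fun t => G r t i j)^`() z.

Definition partially_derivable (G : mxfield) (r z : R) : Prop :=
  forall i j, derivable (fun s => G s z i j) r 1 /\
              derivable (fun t => G r t i j) z 1.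

Definition derivs_upto2 (G : mxfield) : set mxfield :=
  [set H | H = G \/ H = d_r G \/ H = d_z G \/ H = d_r (d_r G) \/
           H = d_r (d_z G) \/ H = d_z (d_r G) \/ H = d_z (d_z G)].

Definition C2_on_rpos (G : mxfield) : Prop :=
  (forall r z, 0 < r ->
     partially_derivable G r z /\ partially_derivable (d_r G) r z /\
     partially_derivable (d_z G) r z) /\
  (forall H, derivs_upto2 G H ->
     forall i j, {within [set p : R * R | 0 < p.1],
                  continuous (fun p : R * R => H p.1 p.2 i j)}).

Definition bounded_near_axis (H : mxfield) (z0 : R) : Prop :=
  exists delta M : R, 0 < delta /\ forall r z, 0 < r < delta -> `|z - z0| < delta ->
    forall i j, `|H r z i j| <= M.

Definition isolated_set (E : set R) : Prop :=
  forall z, E z -> exists eps : R, 0 < eps /\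
    forall w, E w -> `|w - z| < eps -> w = z.

Definition orthogonal_mx (L : 'M[R]_n) : Prop := L^T *m L = 1%:M.

Definition dimker (A : 'M[R]_n) : nat := \rank (kermx A).

End Defs.

(* Main.v *)
Require Import Defs.
From HB Require Import structures.
From mathcomp Require Import all_boot all_order all_algebra.
From mathcomp Require Import all_classical all_reals all_analysis.
From mathcomp Require Import ring lra.
Set Implicit Arguments.
Unset Strict Implicit.
Unset Printing Implicit Defensive.
Import Order.TTheory GRing.Theory Num.Theory.
Import numFieldNormedType.Exports.
Local Open Scope ring_scope.
Local Open Scope classical_set_scope.

(** For r > 0 the equation, multiplied by G det G, reads
    det G * Lap G = G_r adj(G) G_r + G_z adj(G) G_z.
    As r -> 0+ the left-hand side vanishes, because |det G| = r^2 and the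
    derivatives stay bounded, while inside the rod adj(G) tends to c k k^T,
    with c != 0 and k spanning ker G(0,z).  Hence |G_r k|^2 + |G_z k|^2 -> 0,
    so G_z(r,z) k -> 0.  A second-order Taylor expansion in z then gives
    G(0,z') k = O((z' - z)^2), whence the normalized kernel vector of G(0,z)
    has zero derivative at every z off a discrete set; being continuous, it is
    locally constant, so ker G(0,z) is constant on the rod and, by
    continuity, contained in the kernel at the end points. *)

(** * Linear algebra of symmetric matrices with a one-dimensional kernel *)

(** In the expansion along row [i] the cofactors do not involve that row, so only the term of the
    entry [(i, i)] changes. *)
Lemma det_add_delta (R : comRingType) (n : nat) (A : 'M[R]_n) (i : 'I_n) :
  \det (A + delta_mx i i) = \det A + cofactor A i i.
Proof.
have cof j : cofactor (A + delta_mx i i) i j = cofactor A i j.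
  rewrite /cofactor; congr (_ * \det _); apply/matrixP => a b.
  by rewrite !mxE eq_sym (negbTE (neq_lift _ _)) addr0.
rewrite (expand_det_row (A + _) i) (expand_det_row A i).
under eq_bigr => j _ do rewrite cof mxE mulrDl.
rewrite big_split /=; congr (_ + _).
rewrite (bigD1 i) //= big1 ?addr0 => [|j ji].
  by rewrite mxE !eqxx mul1r.
by rewrite mxE (negbTE ji) andbF mul0r.
Qed.

(** [kermx] consists of row vectors killed from the left; symmetry turns it into the kernel acting
    on columns. *)
Lemma dimker1P (R : realType) (n : nat) (S : 'M[R]_n) :
  S^T = S -> dimker S = 1%N ->
  exists k : 'cV[R]_n, [/\ k != 0, S *m k = 0 &
    forall x : 'cV[R]_n, S *m x = 0 -> exists t, x = t *: k].
Proof.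
move=> Ssym rk1; have nzK : nz_row (kermx S) != 0.
  rewrite nz_row_eq0 -mxrank_eq0.
  by move: rk1; rewrite /dimker => ->.
have kerP (x : 'cV[R]_n) : (S *m x == 0) = (x^T <= kermx S)%MS.
  by rewrite sub_kermx -[in RHS]Ssym -trmx_mul trmx_eq0.
exists (nz_row (kermx S))^T; split.
- by rewrite trmx_eq0.
- by apply/eqP; rewrite kerP trmxK nz_row_sub.
move=> x /eqP; rewrite kerP => xK.
have sub : (kermx S <= nz_row (kermx S))%MS.
  rewrite -(mxrank_leqif_sup (nz_row_sub _)).
  by rewrite -/(dimker S) rk1 rank_rV nzK.
have /sub_rVP[t xt] := submx_trans xK sub.
by exists t; rewrite -[x]trmxK xt linearZ.
Qed.

(** If [(S + E_ii) x = 0], multiplying by [k^T] on the left leaves [k_i x_i = 0], so [x_i = 0] and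
    [S x = 0]. Then [x = t k], and [x_i = 0] forces [t = 0]. *)
Lemma unit_add_delta (R : fieldType) (n : nat) (S : 'M[R]_n) (k : 'cV[R]_n)
    (i : 'I_n) :
  S^T = S -> S *m k = 0 -> k i 0 != 0 ->
  (forall x : 'cV[R]_n, S *m x = 0 -> exists t, x = t *: k) ->
  S + delta_mx i i \in unitmx.
Proof.
move=> Ssym Sk ki span; rewrite -unitmx_tr.
have kS : k^T *m S = 0 by rewrite -[S]Ssym -trmx_mul Sk trmx0.
rewrite unitmxE unitfE; apply/det0P => -[v v0 /(congr1 trmx)].
rewrite trmx_mul trmxK trmx0 mulmxDl => vM.
have dv : delta_mx i i *m v^T = v 0 i *: delta_mx i 0.
  apply/matrixP => a b; rewrite !mxE (bigD1 i) //= big1 ?addr0.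
    by rewrite !mxE !ord1 eqxx !andbT mulrC.
  by move=> j ji; rewrite mxE (negbTE ji) andbF mul0r.
have vi : v 0 i = 0.
  have := congr1 (mulmx k^T) vM.
  rewrite mulmxDr mulmxA kS mul0mx add0r mulmx0 dv -scalemxAr -colE.
  move=> /matrixP/(_ 0 0)/eqP; rewrite !mxE mulf_eq0 (negbTE ki) orbF.
  by move=> /eqP.
move: vM; rewrite dv vi scale0r addr0 => /span[t vt].
case/negP: v0; rewrite -[v]trmxK vt.
have /matrixP/(_ i 0)/esym/eqP := vt; rewrite !mxE vi mulf_eq0 (negbTE ki) orbF.
by move=> /eqP ->; rewrite scale0r trmx0.
Qed.

(** As [S adj(S) = det(S) = 0], each column of the adjugate lies on the line of [k], and symmetry
    leaves only a multiple of [k k^T]. The factor is nonzero because the cofactor at [(i, i)] equals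
    [det(S + E_ii)], and that matrix is invertible. *)
Lemma adj_kernel (R : fieldType) (n : nat) (S : 'M[R]_n) (k : 'cV[R]_n) :
  S^T = S -> k != 0 -> S *m k = 0 ->
  (forall x : 'cV[R]_n, S *m x = 0 -> exists t, x = t *: k) ->
  exists2 c, c != 0 & forall a b, (\adj S) a b = c * (k a 0 * k b 0).
Proof.
move=> Ssym k0 Sk span.
have [i ki] : exists i, k i 0 != 0.
  by have /matrix0Pn[i [j]] := k0; rewrite ord1; exists i.
have det0 : \det S = 0.
  apply/eqP/det0P; exists k^T; first by rewrite trmx_eq0.
  by rewrite -[S]Ssym -trmx_mul Sk trmx0.
have adjii : (\adj S) i i != 0.
  have := unit_add_delta Ssym Sk ki span.
  by rewrite unitmxE unitfE det_add_delta det0 add0r mxE.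
have colP b : exists t, forall a, (\adj S) a b = t * k a 0.
  have /span[t] : S *m col b (\adj S) = 0.
    rewrite colE mulmxA mul_mx_adj det0 -colE.
    by apply/matrixP => ? ?; rewrite !mxE mul0rn.
  by move=> /matrixP e; exists t => a; have := e a 0; rewrite !mxE.
have symA a b : (\adj S) a b = (\adj S) b a.
  by have /matrixP/(_ b a) := trmx_adj S; rewrite Ssym mxE.
exists ((\adj S) i i / k i 0 ^+ 2).
  by rewrite mulf_neq0 // invr_eq0 expf_neq0.
move=> a b; have [t tP] := colP b; have [s sP] := colP i.
have tE : t = s * k b 0 / k i 0.
  by rewrite -sP symA tP mulfK.
by rewrite tP tE sP; field.
Qed.

Lemma orthogonal_col0 (R : realType) (n : nat) (k : 'cV[R]_n.+1) :
  k != 0 -> exists L : 'M[R]_n.+1, orthogonal_mx L /\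
    exists t, col 0 L = t *: k.
Proof.
move=> k0; pose q := \sum_i k i 0 ^+ 2.
have q0 : 0 < q.
  rewrite lt_neqAle sumr_ge0 ?andbT; last by move=> *; exact: sqr_ge0.
  apply/negP => /eqP/esym q0; case/negP: k0; apply/eqP/matrixP => i j.
  rewrite ord1 mxE; apply/eqP; rewrite -sqrf_eq0.
  by rewrite (psumr_eq0P _ q0) // => *; exact: sqr_ge0.
pose v := (Num.sqrt q)^-1 *: k.
have vv : v^T *m v = 1%:M.
  apply/matrixP => i j; rewrite !ord1 !mxE eqxx.
  under eq_bigr => a _ do rewrite !mxE -expr2 exprMn.
  by rewrite -mulr_sumr exprVn sqr_sqrtr ?ltW// mulVf ?gt_eqF.
pose e : 'cV[R]_n.+1 := delta_mx 0 0.
have ee : e^T *m e = 1%:M.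
  rewrite trmx_delta mul_delta_mx; apply/matrixP => i j.
  by rewrite !ord1 !mxE.
suff [L [Lo Le]] : exists L : 'M[R]_n.+1, orthogonal_mx L /\ L *m e = v.
  by exists L; split=> //; exists (Num.sqrt q)^-1; rewrite colE Le.
(* When [v = e] the reflection used below degenerates, and the identity serves instead. *)
have [->|ve] := eqVneq v e.
  by exists 1%:M; split; rewrite /orthogonal_mx ?trmx1 mul1mx.
pose w := v - e; pose b := (v^T *m e) 0 0.
have ve_b : v^T *m e = b%:M by rewrite [LHS]mx11_scalar.
have ev_b : e^T *m v = b%:M.
  by rewrite -[LHS]trmxK trmx_mul trmxK ve_b tr_scalar_mx.
have wwE : w^T *m w = (2 * (1 - b))%:M.
  rewrite /w [(v - e)^T]linearB /= mulmxBr !mulmxBl vv ee ve_b ev_b.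
  by rewrite -!raddfB /=; congr (_%:M); ring.
have b1 : 1 - b != 0.
  apply: contra ve => /eqP b1; have ww0 : w^T *m w = 0.
    by rewrite wwE b1 mulr0; apply/matrixP => i j; rewrite !mxE mul0rn.
  have w0 i : w i 0 = 0.
    have s0 : \sum_a w a 0 ^+ 2 = 0.
      have /matrixP/(_ 0 0) := ww0; rewrite mxE [RHS]mxE => s0; rewrite -[RHS]s0.
      by apply: eq_bigr => a _; rewrite [w^T _ _]mxE -expr2.
    apply/eqP; rewrite -sqrf_eq0.
    by rewrite (psumr_eq0P _ s0) // => *; exact: sqr_ge0.
  rewrite -subr_eq0 -/w; apply/eqP/matrixP => i j.
  by rewrite ord1 w0 mxE.
(* The Householder reflection along [w = v - e], which exchanges [e] and [v]. Since
   [|w|^2 = 2 (1 - b)], the usual factor [2 / |w|^2] is [1 / (1 - b)]. *)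
exists (1%:M - (1 - b)^-1 *: (w *m w^T)); split.
  set E := w *m w^T; have EE : E *m E = (2 * (1 - b)) *: E.
    by rewrite /E -mulmxA (mulmxA w^T w) wwE mul_scalar_mx scalemxAr.
  have EN : E^T = E by rewrite /E trmx_mul trmxK.
  rewrite /orthogonal_mx [(_ - _)^T]linearB /= trmx1 linearZ /= EN.
  rewrite mulmxBl mul1mx mulmxBr mulmx1 -scalemxAl -scalemxAr EE !scalerA.
  rewrite -[RHS]addr0 -addrA; congr (_ + _).
  rewrite opprB -scalerBl -scaleNr -scalerDl (_ : _ + _ = 0) ?scale0r//.
  by field.
rewrite mulmxBl mul1mx -scalemxAl -mulmxA.
have -> : w^T *m e = (b - 1)%:M.
  by rewrite /w [(v - e)^T]linearB /= mulmxBl ve_b ee -raddfB.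
rewrite mul_mx_scalar scalerA (_ : _ * _ = -1); last by field.
rewrite scaleN1r opprK.
by rewrite /w addrC subrK.
Qed.

(** * Entrywise limits of determinants, adjugates and inverses *)

Lemma cvg_det (R : realType) (n : nat) (T : Type) (F : set_system T)
    {FF : Filter F} (A : T -> 'M[R]_n) (B : 'M[R]_n) :
  (forall i j, A x i j @[x --> F] --> B i j) ->
  \det (A x) @[x --> F] --> \det B.
Proof.
move=> AB; rewrite /determinant.
apply: cvg_big => [|s _]; first exact: add_continuous.
apply: cvgM; first exact: cvg_cst.
by apply: cvg_big => [|i _]; [exact: mul_continuous|exact: AB].
Qed.

Lemma cvg_adj (R : realType) (n : nat) (T : Type) (F : set_system T)
    {FF : Filter F} (A : T -> 'M[R]_n) (B : 'M[R]_n) :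
  (forall i j, A x i j @[x --> F] --> B i j) ->
  forall i j, (\adj (A x)) i j @[x --> F] --> (\adj B) i j.
Proof.
move=> AB i j; under eq_fun do rewrite mxE; rewrite mxE.
apply: cvgM; first exact: cvg_cst.
apply: cvg_det => a b; rewrite !mxE; under eq_fun do rewrite !mxE.
exact: AB.
Qed.

Lemma cvg_invmx (R : realType) (n : nat) (T : Type) (F : set_system T)
    {FF : Filter F} (A : T -> 'M[R]_n) (B : 'M[R]_n) :
  B \in unitmx -> (forall i j, A x i j @[x --> F] --> B i j) ->
  forall i j, invmx (A x) i j @[x --> F] --> invmx B i j.
Proof.
move=> uB AB i j.
have detB : \det B != 0 by rewrite -unitfE -unitmxE.
have invE (C : 'M[R]_n) : \det C != 0 ->
    invmx C i j = (\det C)^-1 * (\adj C) i j.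
  by move=> C0; rewrite /invmx unitmxE unitfE C0 mxE.
rewrite invE//.
have cd := cvg_det AB.
(* [invmx] returns a singular matrix unchanged, so the adjugate formula holds only eventually, once
   [det (A x)] is nonzero. *)
apply: (@cvg_trans _ ((fun x => (\det (A x))^-1 * (\adj (A x)) i j) @ F)).
  apply: near_eq_cvg.
  by near=> x; rewrite invE//; near: x; exact: cvgr_neq0 (cd _) detB.
by apply: cvgM; [exact: cvgV detB (cd _)|exact: cvg_adj].
Unshelve. all: by end_near. Qed.

Lemma cvg0M_bounded (R : realType) (T : Type) (F : set_system T)
    {FF : Filter F} (f g : T -> R) (M : R) :
  f x @[x --> F] --> 0 -> (\forall x \near F, `|g x| <= M) ->
  f x * g x @[x --> F] --> 0.
Proof.
move=> f0 gM; apply/norm_cvg0P.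
apply: (@squeeze_cvgr _ _ _ _ (cst 0) (fun x => `|f x| * M)).
- near=> x; rewrite normr_ge0 normrM ler_wpM2l//.
  by near: x.
- exact: cvg_cst.
- rewrite -(mul0r M); apply: cvgM; last exact: cvg_cst.
  by rewrite -(normr0 R); apply: cvg_norm.
Unshelve. all: by end_near. Qed.

(** * Consequences of the mean value theorem in one variable *)

(** The ball of radius [|b - a|] around [a] contains the segment between [a] and [b] in either
    order, so one statement covers both. *)
Lemma lipschitz_is_derive (R : realType) (f df : R -> R) (a b M : R) :
  (forall x, `|x - a| <= `|b - a| -> is_derive x 1 f (df x)) ->
  (forall x, `|x - a| <= `|b - a| -> `|df x| <= M) ->
  `|f b - f a| <= M * `|b - a|.
Proof.
move=> fdf dfM.
have near_ab x : (a <= x <= b) || (b <= x <= a) -> `|x - a| <= `|b - a|.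
  case/orP => /andP[ax xb]; first by rewrite !ger0_norm; lra.
  by rewrite !ler0_norm; lra.
have [ab|/ltW ba] := leP a b.
- have Iab x : x \in `[a, b]%R -> `|x - a| <= `|b - a|.
    by rewrite in_itv /= => xab; apply: near_ab; rewrite xab.
  have [x /subset_itv_oo_cc /Iab /fdf//| |c /Iab/dfM cM ->] :=
    @MVT_segment _ f df a b ab.
    by apply: derivable_within_continuous => x /Iab/fdf[].
  by rewrite normrM ler_wpM2r.
- have Iab x : x \in `[b, a]%R -> `|x - a| <= `|b - a|.
    by rewrite in_itv /= => xab; apply: near_ab; rewrite xab orbT.
  have [x /subset_itv_oo_cc /Iab /fdf//| |c /Iab/dfM cM] :=
    @MVT_segment _ f df b a ba.
    by apply: derivable_within_continuous => x /Iab/fdf[].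
  rewrite distrC => ->.
  by rewrite normrM (distrC b) ler_wpM2r.
Qed.

Lemma is_derive_quadratic0 (R : realType) (f : R -> R) (x C : R) :
  (\forall y \near x, `|f y - f x| <= C * (y - x) ^+ 2) ->
  is_derive x 1 f 0.
Proof.
move=> /nbhs_ballP[d /= d0 fC].
suff fx : (fun h : R => h^-1 *: (f (h *: (1 : R) + x) - f x)) @ 0^' --> (0 : R).
  apply: DeriveDef; first by apply/cvg_ex; exists 0; exact: fx.
  exact: cvg_lim.
apply/norm_cvg0P.
apply: (@squeeze_cvgr _ _ _ _ (cst 0) (fun h => C * `|h|)).
- near=> h.
  have h0 : h != 0 by near: h; exact: nbhs_dnbhs_neq.
  rewrite normr_ge0 /= normrM normfV ler_pdivrMl ?normr_gt0//.
  have := fC (h + x); rewrite /ball /= opprD addrA addrAC subrr.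
  rewrite sub0r normrN addrK scaler1 => fCh.
  apply: (le_trans (fCh _)); last first.
    by rewrite -(real_normK (num_real h)) expr2 mulrCA.
  near: h; apply: dnbhs0_lt => //.
- exact: cvg_cst.
- rewrite -[X in _ --> X](mulr0 C); apply: cvgM; first exact: cvg_cst.
  by apply/norm_cvg0P; exact: cvg_within.
Unshelve. all: by end_near. Qed.

(** Local constancy gives derivative zero everywhere, so the mean value theorem replaces a
    connectedness argument. *)
Lemma near_eq_cst_itv (R : realType) (f : R -> R) (a b : R) : a <= b ->
  (forall x, a <= x <= b -> \forall y \near x, f y = f x) -> f a = f b.
Proof.
move=> ab fx.
have df x : a <= x <= b -> is_derive x 1 f 0.
  move=> /fx fxx; apply: near_eq_is_derive (is_derive_cst (f x) x 1).
  by apply: filterS fxx => y.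
have [x /subset_itv_oo_cc| |c _ /eqP] := @MVT_segment _ f (cst 0) a b ab.
- by rewrite /= in_itv /=; exact: df.
- by apply: derivable_within_continuous => x; rewrite in_itv /= => /df[].
- by rewrite mul0r subr_eq0 => /eqP.
Qed.

(** The mean value theorem asks for a derivative only inside the interval. With [x] as an end point,
    continuity at [x] is enough; this absorbs the isolated points where the derivatives of [G] may
    blow up. *)
Lemma punctured_is_derive0_cst (R : realType) (f : R -> R) (x d : R) :
  (forall y, `|x - y| < d -> f t @[t --> y] --> f y) ->
  (forall y, `|x - y| < d -> y != x -> is_derive y 1 f 0) ->
  forall y, `|x - y| < d -> f y = f x.
Proof.
move=> cf df y xy; have [yx|xy'|-> //] := ltgtP y x.
- have sub t : y <= t <= x -> `|x - t| < d.
    by move=> /andP[? ?]; move: xy; rewrite !ger0_norm; lra.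
  have [t|t|c _ /eqP] := @MVT _ f (cst 0) y x yx.
  + rewrite in_itv /= => /andP[yt tx]; apply: df; last by rewrite lt_eqF.
    by apply: sub; rewrite !ltW.
  + apply: continuous_in_subspaceT => {}t; rewrite inE /= in_itv /= => yt.
    exact/cf/sub.
  + by rewrite mul0r subr_eq0 => /eqP.
- have sub t : x <= t <= y -> `|x - t| < d.
    by move=> /andP[? ?]; move: xy; rewrite !ler0_norm; lra.
  have [t|t|c _ /eqP] := @MVT _ f (cst 0) x y xy'.
  + rewrite in_itv /= => /andP[xt ty]; apply: df; last by rewrite gt_eqF.
    by apply: sub; rewrite !ltW.
  + apply: continuous_in_subspaceT => {}t; rewrite inE /= in_itv /= => yt.
    exact/cf/sub.
  + by rewrite mul0r subr_eq0 => /eqP.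
Qed.

(** * Limits of matrix products and of bounded multiples of null functions *)

Lemma cvg_mulmx (R : realType) (m n p : nat) (T : Type) (F : set_system T)
    {FF : Filter F} (A : T -> 'M[R]_(m, n)) (B : T -> 'M[R]_(n, p))
    (A0 : 'M[R]_(m, n)) (B0 : 'M[R]_(n, p)) :
  (forall i j, A x i j @[x --> F] --> A0 i j) ->
  (forall i j, B x i j @[x --> F] --> B0 i j) ->
  forall i j, (A x *m B x) i j @[x --> F] --> (A0 *m B0) i j.
Proof.
move=> AA0 BB0 i j; under eq_fun do rewrite mxE; rewrite mxE.
by apply: cvg_big => [|a _]; [exact: add_continuous|exact: cvgM].
Qed.

Lemma cvg_sum0 (R : realType) (I : finType) (T : Type) (F : set_system T)
    {FF : Filter F} (f : I -> T -> R) :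
  (forall i, f i x @[x --> F] --> 0) -> \sum_i f i x @[x --> F] --> 0.
Proof.
move=> f0.
suff : \sum_i f i x @[x --> F] --> \sum_(i : I) (0 : R) by rewrite big1.
by apply: cvg_big => [|i _]; [exact: add_continuous|exact: f0].
Qed.

Lemma cvg0_mulmx_bounded (R : realType) (n : nat) (T : Type)
    (F : set_system T) {FF : Filter F} (A X : T -> 'M[R]_n) (M : R) :
  (forall i j, A x i j @[x --> F] --> 0) ->
  (\forall x \near F, forall i j, `|X x i j| <= M) ->
  forall i j, (X x *m A x *m X x) i j @[x --> F] --> 0.
Proof.
move=> A0 XM i j; under eq_fun do rewrite mxE.
apply: cvg_sum0 => a.
apply: (cvg0M_bounded (M := M)); last by near=> x; near: x; apply: filterS XM.
under eq_fun do rewrite mxE.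
apply: cvg_sum0 => b.
under eq_fun do rewrite mulrC.
by apply: (cvg0M_bounded (M := M)); last by near=> x; near: x; apply: filterS XM.
Unshelve. all: by end_near. Qed.

Lemma cvg0_sqr (R : realType) (T : Type) (F : set_system T) {FF : Filter F}
    (f : T -> R) :
  f x ^+ 2 @[x --> F] --> 0 -> f x @[x --> F] --> 0.
Proof.
move=> f0; apply/cvgr0Pnorm_lt => e e0.
have : \forall x \near F, `|f x ^+ 2| < e ^+ 2.
  by apply: (cvgr0_norm_lt _ f0); exact: exprn_gt0.
by apply: filterS => x; rewrite normrX ltr_pXn2r// ?nnegrE ?ltW.
Qed.

(** * Continuity of the field at the axis, across it and along it *)

Section AxisCont.
Context (R : realType) (n : nat) (G : mxfield R n)
  (Gcont : forall i j, {within [set p : R * R | 0 <= p.1],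
                        continuous (fun p : R * R => G p.1 p.2 i j)}).

Lemma cvg_to_axis (z : R) i j : G r z i j @[r --> 0^'+] --> G 0 z i j.
Proof.
have /subspace_continuousP/(_ (0, z) (lexx 0)) cG := @Gcont i j.
have c : (r, z) @[r --> 0^'+] --> (nbhs (0 : R), nbhs z).
  by apply: cvg_pair; [apply: cvg_at_right_filter; exact: cvg_id|exact: cvg_cst].
apply: (cvg_comp (G := within [set p : R * R | 0 <= p.1] (nbhs ((0 : R), z)))
  (fun r : R => (r, z)) (fun p : R * R => G p.1 p.2 i j) _ cG).
move=> P wP.
have := c _ wP; apply: filterS2 (nbhs_right_ge (0 : R)).
by move=> r r0; apply.
Qed.

Lemma cvg_along_axis (z : R) i j : G 0 t i j @[t --> z] --> G 0 z i j.
Proof.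
have /subspace_continuousP/(_ (0, z) (lexx 0)) cG := @Gcont i j.
have c : ((0 : R), t) @[t --> z] --> (nbhs (0 : R), nbhs z).
  by apply: cvg_pair; [exact: cvg_cst|exact: cvg_id].
apply: (cvg_comp (G := within [set p : R * R | 0 <= p.1] (nbhs ((0 : R), z)))
  (fun t : R => ((0 : R), t)) (fun p : R * R => G p.1 p.2 i j) _ cG).
move=> P wP.
have : \forall t \near z, 0 <= (0 : R) -> P (0, t) := c _ wP.
by apply: filterS => t; apply; exact: lexx.
Qed.

End AxisCont.

(** Multiplying by [S] and by [det S] clears the inverses, since [det S] times the inverse of [S] is
    the adjugate. The resulting form has a limit on the axis, where [S] becomes singular. *)
Lemma scale_det_sqr_invmx (F : fieldType) (n : nat) (S P Q L : 'M[F]_n.+1) :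
  \det S != 0 ->
  invmx S *m L = (invmx S *m P) ^+ 2 + (invmx S *m Q) ^+ 2 ->
  \det S *: L = P *m \adj S *m P + Q *m \adj S *m Q.
Proof.
move=> det0; have Su : S \in unitmx by rewrite unitmxE unitfE.
have sqr X : S *m (invmx S *m X) ^+ 2 = X *m invmx S *m X.
  by rewrite expr2 -mulmxE -mulmxA mulKVmx// mulmxA.
have adjS X : X *m \adj S *m X = \det S *: (X *m invmx S *m X).
  rewrite [RHS]scalemxAl scalemxAr /invmx Su scalerA divff//.
  by rewrite scale1r.
move=> /(congr1 (mulmx S)); rewrite mulKVmx// mulmxDr !sqr => ->.
by rewrite !adjS scalerDr.
Qed.

(** * Bounds on derivatives near the axis *)

Section NearAxis.
Context (R : realType) (n : nat).
Implicit Types (G H : mxfield R n).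

Lemma bounded_near_axis_near H (z0 : R) :
  bounded_near_axis H z0 -> \forall z \near z0, bounded_near_axis H z.
Proof.
move=> [d [M [d0 HM]]]; near=> z.
have zd : `|z - z0| < d / 2.
  by near: z; apply: cvgr_distC_lt; [exact: cvg_id|rewrite divr_gt0].
exists (d / 2), M; split; first by rewrite divr_gt0.
move=> r w /andP[r0 rd] wd; apply: HM; first by rewrite r0 /=; lra.
by have := ler_distD z w z0; lra.
Unshelve. all: by end_near. Qed.

Lemma bounded_near_axis_right H (z : R) : bounded_near_axis H z ->
  exists M, \forall r \near 0^'+, forall i j, `|H r z i j| <= M.
Proof.
move=> [d [M [d0 HM]]]; exists M; near=> r; apply: HM.
  by apply/andP; split; near: r; [exact: nbhs_right_gt|exact: nbhs_right_lt].
by rewrite subrr normr0.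
Unshelve. all: by end_near. Qed.

(** These are the derivatives that enter the field equation and the Taylor expansion in [z]. *)
Definition finite_derivs G (z : R) :=
  [/\ bounded_near_axis (d_r G) z, bounded_near_axis (d_z G) z,
      bounded_near_axis (d_r (d_r G)) z & bounded_near_axis (d_z (d_z G)) z].

End NearAxis.

(** * The kernel of [G(0, z)] for a solution of the field equation *)

Section Field.
Context (R : realType) (n : nat) (G : R -> R -> 'M[R]_n.+1).
Hypothesis Gsym : forall r z, 0 <= r -> (G r z)^T = G r z.
Hypothesis Gcont : forall i j, {within [set p : R * R | 0 <= p.1],
  continuous (fun p : R * R => G p.1 p.2 i j)}.
Hypothesis Gdet : forall r z, 0 <= r -> `|\det (G r z)| = r ^+ 2.
Hypothesis Greg : C2_on_rpos G.
Hypothesis Geq : forall r z, 0 < r ->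
  invmx (G r z) *m (d_r (d_r G) r z + r^-1 *: d_r G r z + d_z (d_z G) r z)
  = (invmx (G r z) *m d_r G r z) ^+ 2 + (invmx (G r z) *m d_z G r z) ^+ 2.

Lemma d_z_sym r z : 0 < r -> (d_z G r z)^T = d_z G r z.
Proof.
move=> r0; apply/matrixP => i j; rewrite !mxE; congr (_^`() _).
by apply/funext => t; rewrite -[in LHS]Gsym ?ltW// mxE.
Qed.

Lemma d_r_sym r z : 0 < r -> (d_r G r z)^T = d_r G r z.
Proof.
move=> r0; apply/matrixP => i j; rewrite !mxE !derive1E.
(* [G] is symmetric only for nonnegative [s], so the two functions agree merely near [r > 0]; the
   derivative is local. *)
apply: near_eq_derive; near=> s.
rewrite -[in LHS]Gsym ?mxE//.
by near: s; apply: (cvgr_ge r) => //; exact: cvg_id.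
Unshelve. all: by end_near. Qed.

Lemma adj_eq r z : 0 < r ->
  \det (G r z) *: (d_r (d_r G) r z + r^-1 *: d_r G r z + d_z (d_z G) r z)
  = d_r G r z *m \adj (G r z) *m d_r G r z
    + d_z G r z *m \adj (G r z) *m d_z G r z.
Proof.
move=> r0; apply: scale_det_sqr_invmx (Geq z r0).
by rewrite -normr_eq0 Gdet ?ltW// expf_neq0// gt_eqF.
Qed.

(** The argument takes the entry [(i, i)] of the cleared equation. Its left side [L] tends to 0, and
    replacing [adj(G)] by its limit [A0 = c k0 k0^T] costs a vanishing error, so [c] times the sum
    of the squares of [(G_r k0)_i] and [(G_z k0)_i] tends to 0. *)
Lemma cvg_d_z_kernel z (k : 'cV[R]_n.+1) :
  finite_derivs G z -> dimker (G 0 z) = 1%N -> G 0 z *m k = 0 ->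
  forall i, (d_z G r z *m k) i 0 @[r --> 0^'+] --> 0.
Proof.
move=> [/bounded_near_axis_right[M1 M1P] /bounded_near_axis_right[M2 M2P]
        /bounded_near_axis_right[M3 M3P] /bounded_near_axis_right[M4 M4P]].
move=> rk Gk i.
have sym0 := Gsym z (lexx 0).
have [k0 [k00 Gk0 span]] := dimker1P sym0 rk.
have [t ->] := span k Gk.
have [c c0 adjE] := adj_kernel sym0 k00 Gk0 span.
suff lim0 : (d_z G r z *m k0) i 0 @[r --> 0^'+] --> 0.
  under eq_fun do rewrite -scalemxAr mxE mulrC.
  by apply: cvg0M_bounded lim0 _; apply: nearW => x; exact: lexx.
pose A0 := \adj (G 0 z); pose E r := \adj (G r z) - A0.
have A0E : A0 = c *: (k0 *m k0^T).
  by apply/matrixP => a b; rewrite adjE !mxE big_ord1 !mxE.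
have quad (X : 'M[R]_n.+1) : X^T = X ->
    (X *m A0 *m X) i i = c * ((X *m k0) i 0) ^+ 2.
  move=> XT; rewrite A0E -scalemxAr -scalemxAl mxE; congr (_ * _).
  have -> : X *m (k0 *m k0^T) *m X = (X *m k0) *m (X *m k0)^T.
    by rewrite trmx_mul XT !mulmxA.
  by rewrite mxE big_ord1 [(X *m k0)^T _ _]mxE expr2.
have subE (X Y : 'M[R]_n.+1) a b : (X - Y) a b = X a b - Y a b by rewrite !mxE.
have E0 a b : E r a b @[r --> 0^'+] --> 0.
  suff : (\adj (G r z)) a b - A0 a b @[r --> 0^'+] --> A0 a b - A0 a b.
    rewrite subrr; apply: cvg_trans; apply: near_eq_cvg; near=> r.
    by rewrite /E subE.
  apply: cvgB; last exact: cvg_cst.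
  by apply: cvg_adj => ? ?; exact: cvg_to_axis.
have det0 : \det (G r z) @[r --> 0^'+] --> 0.
  have detG0 : \det (G 0 z) = 0.
    by apply/eqP; rewrite -normr_eq0 Gdet// expr0n.
  rewrite -[X in _ --> X]detG0.
  by apply: cvg_det => ? ?; exact: cvg_to_axis.
(* The singular factor [1/r] of the Laplacian is harmless: [|det G| / r = r]. *)
have detr0 : \det (G r z) / r @[r --> 0^'+] --> 0.
  apply/norm_cvg0P; apply: (@cvg_trans _ (r @[r --> 0^'+])).
    apply: near_eq_cvg; near=> r.
    have r0 : 0 < r by near: r; exact: nbhs_right_gt.
    by rewrite normrM normfV Gdet ?ltW// gtr0_norm// expr2 mulfK// gt_eqF.
  by apply: cvg_at_right_filter; exact: cvg_id.
pose L r := \det (G r z) *: (d_r (d_r G) r z + r^-1 *: d_r G r z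
                             + d_z (d_z G) r z).
have L0 : L r i i @[r --> 0^'+] --> 0.
  apply: (@cvg_trans _ ((\det (G r z) * (d_r (d_r G) r z i i)
    + \det (G r z) / r * (d_r G r z i i)
    + \det (G r z) * (d_z (d_z G) r z i i)) @[r --> 0^'+])).
    apply: near_eq_cvg; near=> r.
    have LE (X Y Z : 'M[R]_n.+1) d : (d *: (X + r^-1 *: Y + Z)) i i =
        d * X i i + d / r * Y i i + d * Z i i by rewrite !mxE; ring.
    by rewrite LE.
  have -> : nbhs (0 : R) = nbhs (0 + 0 + 0 : R) by rewrite !addr0.
  apply: cvgD; first apply: cvgD.
  - by apply: cvg0M_bounded det0 _; apply: filterS M3P => ? ?.
  - by apply: cvg0M_bounded detr0 _; apply: filterS M1P => ? ?.
  - by apply: cvg0M_bounded det0 _; apply: filterS M4P => ? ?.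
have addE (X Y : 'M[R]_n.+1) : (X + Y) i i = X i i + Y i i by rewrite mxE.
have alg (P Q A X : 'M[R]_n.+1) : P^T = P -> Q^T = Q ->
    X = P *m A *m P + Q *m A *m Q ->
    X i i - (P *m (A - A0) *m P) i i - (Q *m (A - A0) *m Q) i i
    = c * (((P *m k0) i 0) ^+ 2 + ((Q *m k0) i 0) ^+ 2).
  move=> PT QT ->; rewrite mulrDr -!quad// !(mulmxBr, mulmxBl) addE !subE.
  ring.
have lim : c * (((d_r G r z *m k0) i 0) ^+ 2 + ((d_z G r z *m k0) i 0) ^+ 2)
    @[r --> 0^'+] --> 0.
  apply: (@cvg_trans _ ((L r i i - (d_r G r z *m E r *m d_r G r z) i i
    - (d_z G r z *m E r *m d_z G r z) i i) @[r --> 0^'+])).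
    apply: near_eq_cvg; near=> r.
    have r0 : 0 < r by near: r; exact: nbhs_right_gt.
    by rewrite (alg _ _ _ _ (d_r_sym z r0) (d_z_sym z r0) (adj_eq z r0)).
  have -> : nbhs (0 : R) = nbhs (0 - 0 - 0 : R) by rewrite !subr0.
  apply: cvgB; first apply: cvgB => //.
  - exact: cvg0_mulmx_bounded E0 M1P _ _.
  - exact: cvg0_mulmx_bounded E0 M2P _ _.
apply: cvg0_sqr.
(* Both squares carry the same nonzero factor [c], so its sign does not matter: after division by
   [c] their sum dominates the square of the [z]-derivative term. *)
apply: (@squeeze_cvgr _ _ _ _ (cst 0) (fun r => c^-1 * (c *
  (((d_r G r z *m k0) i 0) ^+ 2 + ((d_z G r z *m k0) i 0) ^+ 2)))).
- by near=> r; rewrite mulKf// sqr_ge0 /= lerDr sqr_ge0.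
- exact: cvg_cst.
- rewrite -[X in _ --> X](mulr0 c^-1); apply: cvgM lim; exact: cvg_cst.
Unshelve. all: by end_near. Qed.

(** The mean value bound is applied twice: to [d_z G], giving [|d_z G(t) - D| <= M |t - z|], and
    then to [G - t D]. The constant does not depend on [r], so the estimate survives [r -> 0+]. *)
Lemma d_z_taylor (z z' M r : R) i j : 0 < r ->
  (forall t, `|t - z| <= `|z' - z| -> `|d_z (d_z G) r t i j| <= M) ->
  `|G r z' i j - G r z i j - (z' - z) * d_z G r z i j| <= M * (z' - z) ^+ 2.
Proof.
move=> r0 HM; have [Gd _] := Greg.
have dG (t : R) : is_derive t 1 (fun t => G r t i j) (d_z G r t i j).
  have [/(_ i j)[_ /derivableP dG] _] := Gd r t r0.
  by rewrite mxE derive1E.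
have dGz (t : R) : is_derive t 1 (fun t => d_z G r t i j) (d_z (d_z G) r t i j).
  have [_ [_ /(_ i j)[_ /derivableP dGz]]] := Gd r t r0.
  by rewrite mxE derive1E.
set D := d_z G r z i j.
have df (t : R) : is_derive t 1 (fun t => G r t i j - t * D) (d_z G r t i j - D).
  have lin : is_derive t (1 : R) (fun t : R => t * D) D.
    have dM := is_deriveM (is_derive_id t (1 : R)) (is_derive_cst D t (1 : R)).
    apply: (is_derive_eq dM).
    by rewrite scaler0 add0r /GRing.scale /= mulr1.
  exact: is_deriveB.
have := @lipschitz_is_derive R _ _ z z' (M * `|z' - z|) (fun t _ => df t).
rewrite (_ : M * `|z' - z| * `|z' - z| = M * (z' - z) ^+ 2); last first.
  by rewrite -mulrA -expr2 real_normK ?num_real.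
rewrite (_ : _ - _ - (_ - _) = G r z' i j - G r z i j - (z' - z) * D); last by ring.
apply=> t tz; apply: (@le_trans _ _ (M * `|t - z|)); last first.
  (* The bound at [t = z] already forces [M] to be nonnegative. *)
  have [M0|M0] := leP 0 M; first exact: ler_wpM2l.
  have := HM z; rewrite subrr normr0 => /(_ (normr_ge0 _)).
  by move=> /(le_trans (normr_ge0 _)); lra.
apply: lipschitz_is_derive (fun x _ => dGz x) _ => x xt.
exact/HM/(le_trans xt).
Qed.

(** The Taylor estimate is applied to [G(r, .) k] for [r > 0] and passed to the limit: the
    zeroth-order term tends to [G(0, z) k = 0] and the first-order term vanishes by
    [cvg_d_z_kernel]. No derivative on the axis itself is taken. *)
Lemma kernel_quadratic (z : R) (k : 'cV[R]_n.+1) :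
  finite_derivs G z -> dimker (G 0 z) = 1%N -> G 0 z *m k = 0 ->
  exists C, \forall z' \near z, forall i,
    `|(G 0 z' *m k) i 0| <= C * (z' - z) ^+ 2.
Proof.
move=> fin rk Gk; have [_ _ _ [d [M [d0 HM]]]] := fin.
exists (\sum_j M * `|k j 0|).
have : \forall z' \near z, `|z' - z| < d.
  exact: (@cvgr_distC_lt _ _ _ _ _ id z cvg_id _ d0).
apply: filterS => z' z'd i.
have lin (X Y Z : 'M[R]_n.+1) s : (X *m k) i 0 - (Y *m k) i 0
    - s * (Z *m k) i 0 = \sum_j (X i j - Y i j - s * Z i j) * k j 0.
  by rewrite !mxE mulr_sumr -!sumrB; apply: eq_bigr => j _; ring.
have ck t : (G r t *m k) i 0 @[r --> 0^'+] --> (G 0 t *m k) i 0.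
  apply: (cvg_mulmx (B := fun=> k)); first exact: cvg_to_axis.
  by move=> *; exact: cvg_cst.
have lim : `|(G r z' *m k) i 0 - (G r z *m k) i 0
    - (z' - z) * (d_z G r z *m k) i 0| @[r --> 0^'+]
    --> `|(G 0 z' *m k) i 0 - (G 0 z *m k) i 0 - (z' - z) * 0|.
  apply: cvg_norm; apply: cvgB; first exact: cvgB.
  apply: cvgM; first exact: cvg_cst.
  exact: cvg_d_z_kernel.
have Gk0 : (G 0 z *m k) i 0 = 0 by rewrite Gk mxE.
rewrite Gk0 mulr0 !subr0 in lim.
apply: (cvgr_to_le lim); near=> r.
have r0 : 0 < r by near: r; exact: nbhs_right_gt.
rewrite lin mulr_suml (le_trans (ler_norm_sum _ _ _))// ler_sum// => j _.
rewrite normrM mulrAC ler_wpM2r//; apply: d_z_taylor => // t tz.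
apply: HM; last exact: le_lt_trans z'd.
by rewrite r0; near: r; exact: nbhs_right_lt.
Unshelve. all: by end_near. Qed.

(* With M z = G(0,z) + E_ii and k_i != 0, the vector u z = (M z)^-1 e_i spans
   ker G(0,z) with u_i = 1, and u z' - u z = - (M z')^-1 G(0,z') (u z). *)
Lemma kernel_locally_constant (z0 : R) :
  (\forall z \near z0, dimker (G 0 z) = 1%N) ->
  (\forall z \near z0^', finite_derivs G z) ->
  \forall z \near z0, forall x : 'cV[R]_n.+1,
    G 0 z0 *m x = 0 <-> G 0 z *m x = 0.
Proof.
move=> rk fin.
have [k [k0 Gk span]] := dimker1P (Gsym z0 (lexx 0)) (nbhs_singleton rk).
have [i ki] : exists i, k i 0 != 0.
  by have /matrix0Pn[i [j]] := k0; rewrite ord1; exists i.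
pose M (z : R) := G 0 z + delta_mx i i.
have cM (z : R) a b : M t a b @[t --> z] --> M z a b.
  rewrite /M; under eq_fun do rewrite mxE; rewrite mxE.
  by apply: cvgD; [exact: cvg_along_axis|exact: cvg_cst].
have Mu0 : M z0 \in unitmx by exact: unit_add_delta (Gsym _ _) Gk ki span.
(* One radius serves all three conditions; the derivative bounds are available only away from [z0],
   which may be exceptional. *)
have [d /= d0 Hd] : exists2 d : R, 0 < d & forall z : R, `|z0 - z| < d ->
    [/\ dimker (G 0 z) = 1%N, M z \in unitmx & z != z0 -> finite_derivs G z].
  apply/nbhs_ballP.
  have detN : \forall z \near z0, \det (M z) != 0.
    by apply: cvgr_neq0 (cvg_det (cM z0)) _; rewrite -unitfE -unitmxE.
  near=> z; split.
  - by near: z.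
  - by rewrite unitmxE unitfE; near: z.
  - by near: z; exact: fin.
pose u (z : R) := col i (invmx (M z)).
have Mu (z : R) : `|z0 - z| < d -> M z *m u z = delta_mx i 0.
  by move=> /Hd[_ Mz _]; rewrite /u colE mulmxA mulmxV// mul1mx.
have delta_mul (x : 'cV[R]_n.+1) : delta_mx i i *m x = x i 0 *: delta_mx i 0.
  apply/matrixP => a b; rewrite !mxE (bigD1 i) //= big1 ?addr0.
    by rewrite !mxE !ord1 eqxx !andbT mulrC.
  by move=> j ji; rewrite mxE (negbTE ji) andbF mul0r.
(* A kernel vector [x] satisfies [M z x = x_i e_i], and [u z] solves [M z (u z) = e_i]. *)
have span_u (z : R) x : `|z0 - z| < d -> G 0 z *m x = 0 -> x = x i 0 *: u z.
  move=> /Hd[_ Mz _] Gx; rewrite /u colE scalemxAr -delta_mul.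
  by rewrite -[delta_mx i i *m x]add0r -Gx -mulmxDl mulKmx.
(* Some nonzero [y] is in the kernel and equals [y_i (u z)], so [y_i] is nonzero and [u z] is in the
   kernel too. *)
have Gu (z : R) : `|z0 - z| < d -> G 0 z *m u z = 0.
  move=> zd; have [rkz Mz _] := Hd z zd.
  have [y [y0 Gy _]] := dimker1P (Gsym z (lexx 0)) rkz.
  have yE := span_u z y zd Gy.
  have yi : y i 0 != 0 by apply: contra y0 => /eqP yi; rewrite yE yi scale0r.
  have := Gy; rewrite yE -scalemxAr => /eqP.
  by rewrite scaler_eq0 (negbTE yi) => /eqP.
have cinv (z : R) a b : `|z0 - z| < d ->
    invmx (M t) a b @[t --> z] --> invmx (M z) a b.
  by move=> /Hd[_ Mz _]; exact: cvg_invmx Mz (cM z) _ _.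
have du (z : R) a : `|z0 - z| < d -> z != z0 -> is_derive z 1 (fun t => u t a 0) 0.
  move=> zd zz0; have [rkz Mz /(_ zz0) finz] := Hd z zd.
  have [C HC] := kernel_quadratic finz rkz (Gu z zd).
  apply: (@is_derive_quadratic0 _ _ _ (\sum_b (`|invmx (M z) a b| + 1) * C)).
  have inv_bnd : \forall t \near z, forall b,
      `|invmx (M t) a b| <= `|invmx (M z) a b| + 1.
    have nF : Filter (nbhs z) by exact: nbhs_filter.
    apply: (@filter_forall R _
      (fun b t => `|invmx (M t) a b| <= `|invmx (M z) a b| + 1) (nbhs z)).
    move=> b; apply: (cvgr_le _ (cvg_norm (cinv z a b zd))).
    by rewrite ltrDl.
  have near_d : \forall t \near z, `|z0 - t| < d.
    have cn : `|z0 - t| @[t --> z] --> `|z0 - z|.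
      by apply: cvg_norm; apply: cvgB; [exact: cvg_cst|exact: cvg_id].
    exact: (cvgr_lt _ cn _ zd).
  near=> t.
  have td : `|z0 - t| < d by near: t.
  have [_ Mt _] := Hd t td.
  have uE : u t - u z = - (invmx (M t) *m (G 0 t *m u z)).
    (* Because [(u z)_i = 1], [M t (u z)] is [G(0, t) (u z) + e_i], and [e_i = M t (u t)]. *)
    have Gt : G 0 t *m u z = M t *m (u z - u t).
      rewrite mulmxBr Mu// /M mulmxDl delta_mul.
      have -> : u z i 0 = 1.
        have := Mu z zd; rewrite /M mulmxDl Gu// add0r delta_mul.
        by move=> /matrixP/(_ i 0); rewrite !mxE eqxx mulr1.
      by rewrite scale1r addrK.
    by rewrite Gt mulKmx// opprB.
  have subE (X Y : 'cV[R]_n.+1) : X a 0 - Y a 0 = (X - Y) a 0 by rewrite !mxE.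
  rewrite subE uE mxE normrN mxE mulr_suml (le_trans (ler_norm_sum _ _ _))//.
  apply: ler_sum => b _; rewrite normrM -mulrA.
  have inv_b : `|invmx (M t) a b| <= `|invmx (M z) a b| + 1.
    by move: b; near: t.
  have Gb : `|(G 0 t *m u z) b 0| <= C * (t - z) ^+ 2 by move: b {inv_b}; near: t.
  exact: ler_pM.
(* The derivative of [u] is known to vanish only off [z0]; continuity bridges that point. *)
have u_cst (z : R) : `|z0 - z| < d -> u z = u z0.
  move=> zd; apply/matrixP => a b; rewrite ord1.
  apply: (@punctured_is_derive0_cst _ (fun t => u t a 0) z0 d _ (du^~ a) z zd).
  move=> y yd; rewrite /u; under eq_fun do rewrite mxE; rewrite mxE.
  exact: cinv.
apply: filterS (near_ball z0 d d0) => z /= zd x.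
have z00 : `|z0 - z0| < d by rewrite subrr normr0.
split=> [/(span_u _ _ z00)|/(span_u _ _ zd)] ->.
- by rewrite -(u_cst z zd) -scalemxAr Gu// scaler0.
- by rewrite u_cst// -scalemxAr Gu// scaler0.
Unshelve. all: by end_near. Qed.

(** Around a point of [E], isolation keeps a punctured neighbourhood free of [E]. At a point outside
    [E], which [E] might still accumulate at, the bounds there extend to a neighbourhood because
    boundedness near the axis is an open condition. *)
Lemma finite_derivs_punctured (E : set R) :
  isolated_set E ->
  (forall z0, ~ E z0 -> forall H, derivs_upto2 G H -> bounded_near_axis H z0) ->
  forall z0 : R, \forall z \near z0^', finite_derivs G z.
Proof.
move=> isoE Efin z0.
have fin z : ~ E z -> finite_derivs G z.
  move=> /Efin fin; split; apply: fin.
  - by right; left.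
  - by do 2!right; left.
  - by do 3!right; left.
  - by do 6!right.
have [Ez0|nEz0] := pselect (E z0).
  have [e [e0 He]] := isoE z0 Ez0.
  near=> z; apply: fin => Ez.
  have : z != z0 by near: z; exact: nbhs_dnbhs_neq.
  move=> /eqP; apply; apply: He => //; rewrite distrC.
  by near: z; apply: nbhs_dnbhs; exact: (near_ball z0 e e0).
have [/bounded_near_axis_near f1 /bounded_near_axis_near f2
  /bounded_near_axis_near f3 /bounded_near_axis_near f4] := fin z0 nEz0.
apply: nbhs_dnbhs.
apply: filterS (filterI (filterI f1 f2) (filterI f3 f4)) => z.
by move=> [[b1 b2] [b3 b4]]; exact: And4 b1 b2 b3 b4.
Unshelve. all: by end_near. Qed.

Lemma kernel_constant (a b : R) (k : 'cV[R]_n.+1) :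
  (forall z, a <= z <= b -> \forall t \near z, dimker (G 0 t) = 1%N) ->
  (forall z, a <= z <= b -> \forall t \near z^', finite_derivs G t) ->
  a <= b -> G 0 a *m k = 0 <-> G 0 b *m k = 0.
Proof.
move=> rk fin ab.
(* The truth value of [G(0, z) k = 0] is encoded as a real function, so that a locally constant
   function can be compared at [a] and [b]. *)
pose f z : R := (G 0 z *m k == 0)%:R.
have fab : f a = f b.
  apply: near_eq_cst_itv => // x xab.
  apply: filterS (kernel_locally_constant (rk x xab) (fin x xab)) => z /(_ k) kE.
  by rewrite /f; congr (nat_of_bool _)%:R; apply/eqP/eqP => /kE.
move: fab; rewrite /f.
case: eqP => [->|Ga]; case: eqP => [->|Gb] // /eqP.
- by rewrite oner_eq0.
- by rewrite eq_sym oner_eq0.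
Qed.

End Field.

(** * Rods with possibly infinite end points, and the constant rotation *)

Lemma near_EFin_gt (R : realType) (y : \bar R) (z : R) :
  (y < z%:E)%E -> \forall t \near z, (y < t%:E)%E.
Proof.
case: y => [a| |] //=; rewrite ?lte_fin => az.
- by near=> t; rewrite lte_fin; near: t; exact: lt_nbhsr.
- by near=> t; exact: ltNyr.
Unshelve. all: by end_near. Qed.

Lemma near_EFin_lt (R : realType) (y : \bar R) (z : R) :
  (z%:E < y)%E -> \forall t \near z, (t%:E < y)%E.
Proof.
case: y => [a| |] //=; rewrite ?lte_fin => az.
- by near=> t; rewrite lte_fin; near: t; exact: lt_nbhsl.
- by near=> t; exact: ltry.
Unshelve. all: by end_near. Qed.

Lemma EFin_between (R : realType) (z1 z2 : \bar R) :
  (z1 < z2)%E -> exists z : R, (z1 < z%:E < z2)%E.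
Proof.
case: z1 z2 => [a| |] [b| |] //=.
- by rewrite lte_fin => ab; exists ((a + b) / 2); rewrite !lte_fin; lra.
- by exists (a + 1); rewrite lte_fin ltry andbT; lra.
- by exists (b - 1); rewrite lte_fin ltNyr /=; lra.
- by exists 0; rewrite ltNyr ltry.
Qed.

Theorem theorem2 (R : realType) (n : nat) (G : R -> R -> 'M[R]_n.+1)
  (z1 z2 : \bar R)
  (Gsym : forall r z, 0 <= r -> (G r z)^T = G r z)
  (Gcont : forall i j, {within [set p : R * R | 0 <= p.1],
                        continuous (fun p : R * R => G p.1 p.2 i j)})
  (Gdet : forall r z, 0 <= r -> `|\det (G r z)| = r ^+ 2)
  (Greg : C2_on_rpos G)
  (Geq : forall r z, 0 < r ->
     invmx (G r z) *m (d_r (d_r G) r z + r^-1 *: d_r G r z + d_z (d_z G) r z)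
     = (invmx (G r z) *m d_r G r z) ^+ 2 + (invmx (G r z) *m d_z G r z) ^+ 2)
  (Gfinite : exists E : set R, isolated_set E /\
     forall z0, ~ E z0 ->
       forall H, derivs_upto2 G H ->
       bounded_near_axis H z0)
  (z12 : (z1 < z2)%E)
  (rod : forall z : R, (z1 < z%:E < z2)%E -> dimker (G 0 z) = 1%N)
  (end1 : forall z : R, z1 = z%:E -> dimker (G 0 z) <> 1%N)
  (end2 : forall z : R, z2 = z%:E -> dimker (G 0 z) <> 1%N) :
  exists L : 'M[R]_n.+1, orthogonal_mx L /\
    forall z : R, (z1 <= z%:E <= z2)%E ->
      forall i, (L^T *m G 0 z *m L) ord0 i = 0.
Proof.
(* The kernel vector [k] at one interior point [w] will serve for the whole rod. *)
have [w wrod] := EFin_between z12.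
have [k [k0 Gwk _]] := dimker1P (Gsym 0 w (lexx 0)) (rod w wrod).
have [E [isoE Efin]] := Gfinite.
have fin z := finite_derivs_punctured isoE Efin z.
have rk (z : R) :
    (z1 < z%:E < z2)%E -> \forall t \near z, dimker (G 0 t) = 1%N.
  move=> /andP[/near_EFin_gt nz1 /near_EFin_lt nz2].
  by apply: filterS2 nz1 nz2 => t z1t tz2; apply: rod; rewrite z1t.
have kerE (a b : R) : a <= b -> (z1 < a%:E)%E -> (b%:E < z2)%E ->
    G 0 a *m k = 0 <-> G 0 b *m k = 0.
  move=> ab z1a bz2.
  apply: (kernel_constant Gsym Gcont Gdet Greg Geq k _ _ ab) => x xab.
    have /andP[ax xb] := xab; apply: rk; apply/andP; split.
      by apply: lt_le_trans z1a _; rewrite lee_fin.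
    by apply: le_lt_trans bz2; rewrite lee_fin.
  exact: fin.
have Gk_open (z : R) : (z1 < z%:E < z2)%E -> G 0 z *m k = 0.
  move=> /andP[z1z zz2]; have /andP[z1w ww2] := wrod.
  have [wz|/ltW zw] := leP w z; first exact: (kerE _ _ wz z1w zz2).1.
  exact: (kerE _ _ zw z1z ww2).2.
(* Taken along a filter that approaches [z] from inside the rod, this carries the kernel relation to
   finite end points by continuity. *)
have Gk_lim (z : R) (F : set_system R) : ProperFilter F -> F --> z ->
    (\forall t \near F, (z1 < t%:E < z2)%E) -> G 0 z *m k = 0.
  move=> FF Fz Frod; apply/matrixP => i j; rewrite ord1 [RHS]mxE.
  apply: (@cvg_unique _ (@Rhausdorff R) ((fun t => (G 0 t *m k) i 0) @ F)).
    have cz : (G 0 t *m k) i 0 @[t --> z] --> (G 0 z *m k) i 0.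
      apply: (cvg_mulmx (B := fun=> k)); first exact: (cvg_along_axis Gcont).
      by move=> *; exact: cvg_cst.
    by apply: cvg_trans cz; exact: cvg_app.
  apply: (@cvg_trans _ (cst (0 : R) @ F)); last exact: cvg_cst.
  apply: near_eq_cvg.
  by apply: filterS Frod => t /Gk_open ->; rewrite mxE.
have Gk z : (z1 <= z%:E <= z2)%E -> G 0 z *m k = 0.
  rewrite !le_eqVlt => /andP[/orP[/eqP z1E|z1z] /orP[/eqP z2E|zz2]].
  - by move: z12; rewrite z1E -z2E ltxx.
  - have Fz : z^'+ --> z by apply: cvg_at_right_filter; exact: cvg_id.
    apply: (Gk_lim z z^'+ _ Fz); rewrite z1E.
    apply: filterS2 (nbhs_right_gt z) (Fz _ (near_EFin_lt zz2)) => t zt tz2.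
    by rewrite lte_fin zt.
  - have Fz : z^'- --> z by apply: cvg_at_left_filter; exact: cvg_id.
    apply: (Gk_lim z z^'- _ Fz); rewrite -z2E.
    apply: filterS2 (nbhs_left_lt z) (Fz _ (near_EFin_gt z1z)) => t tz z1t.
    by rewrite lte_fin tz andbT.
  - by apply: Gk_open; rewrite z1z.
(* With first column [t k], symmetry of [G] makes the first row of [L^T G L] the transpose of
   [G (t k)] times [L], which is zero. *)
have [L [Lo [t Lk]]] := orthogonal_col0 k0.
exists L; split=> // z zrod i.
have : row 0 (L^T *m G 0 z *m L) = 0.
  rewrite !row_mul -tr_col Lk -[G 0 z]Gsym// -trmx_mul -scalemxAr Gk//.
  by rewrite scaler0 trmx0 mul0mx.
by move=> /matrixP/(_ 0 i); rewrite !mxE.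
Qed.
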